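(* Let $X,Y$ be Banach spaces, $p>1$ with conjugate exponent $p_*$, $A\colon X\to Y$ bounded linear, $\mathcal{R}\colon X\to[0,+\infty]$ convex, lower semi-continuous and coercive, $y^\dagger\in Y$, and let $x^\dagger$ be an $\mathcal{R}$-minimising solution of $Ax=y^\dagger$. Assume that $\omega^\dagger\in Y^*$ satisfies $A^*\omega^\dagger\in\partial\mathcal{R}(x^\dagger)$. Assume that $\mathcal{R}^*$ is two times Fréchet differentiable at $A^*\omega^\dagger$ and that there exists an index function $\Phi$ such that $$\langle\omega-\omega^\dagger,J_{p_*}(\omega^\dagger)\rangle\le\Phi\bigl(\mathcal{D}^*_{x^\dagger}(A^*\omega;A^*\omega^\dagger)\bigr)\qquad\text{for all }\omega\in Y^*.$$ If $\Phi(t)=o(t^{1/2})$ as $t\to0$, then $x^\dagger$ minimises $\mathcal{R}$ over $X$. In addition, if one can choose $\Phi(t)\sim t^{1/2}$ as $t\to0$, then $J_{p_*}(\omega^\dagger)\in\operatorname{Ran}A$.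
   Context: Conventions: $\langle\cdot,\cdot\rangle$ is the dual pairing; $1/p+1/p_*=1$; $A^*\colon Y^*\to X^*$ is the adjoint; $\operatorname{Ran}A$ is the range of $A$; coercive means $\mathcal{R}(x)\to\infty$ as $\|x\|\to\infty$; $\partial\mathcal{R}$ is the convex subdifferential. The notation $f(t)\sim g(t)$ as $t\to0$ means that there are constants $0<c_1\le c_2$ with $c_1g(t)\le f(t)\le c_2g(t)$ for all sufficiently small $t>0$. An $\mathcal{R}$-minimising solution of $Ax=y^\dagger$ is an element $x^\dagger\in\arg\min\{\mathcal{R}(x):Ax=y^\dagger\}$. $\mathcal{R}^*\colon X^*\to(-\infty,+\infty]$ is the convex conjugate of $\mathcal{R}$ (the condition $A^*\omega^\dagger\in\partial\mathcal{R}(x^\dagger)$ implies $x^\dagger\in\partial\mathcal{R}^*(A^*\omega^\dagger)$), and the dual Bregman distance is $\mathcal{D}^*_{x^\dagger}(\xi;A^*\omega^\dagger)=\mathcal{R}^*(\xi)-\mathcal{R}^*(A^*\omega^\dagger)-\langle\xi-A^*\omega^\dagger,x^\dagger\rangle\in[0,+\infty]$. Duality mapping on $Y^*$: $J_{p_*}(\omega^\dagger)$ is the element $y\in Y$ with $\langle\omega^\dagger,y\rangle=\|\omega^\dagger\|\|y\|$ and $\|y\|=\|\omega^\dagger\|^{p_*-1}$ (such an element is assumed to exist; if there are several, $J_{p_*}(\omega^\dagger)$ denotes one fixed choice). An index function is a strictly increasing, continuous, concave function $\Phi\colon[0,+\infty)\to[0,+\infty)$ with $\Phi(0)=0$. An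 inequality with right-hand side $\Phi(\mathcal{D}^*_{x^\dagger}(\cdot))$ is regarded as trivially satisfied where $\mathcal{D}^*_{x^\dagger}=+\infty$. *)

(* Defs.v *)
From HB Require Import structures.
From mathcomp Require Import all_boot all_order all_algebra.
From mathcomp Require Import all_classical all_reals all_analysis.

Set Implicit Arguments.
Unset Strict Implicit.
Unset Printing Implicit Defensive.

Import Order.TTheory GRing.Theory Num.Theory.
Import numFieldNormedType.Exports.

Local Open Scope classical_set_scope.
Local Open Scope ring_scope.

(* The topological dual of a real normed space: continuous linear functionals
   with the operator norm |f| = sup_(|x| <= 1) |f x|. *)
Section DualSpace.
Context (R : realType) (V : normedModType R).

Definition dual_pred : {pred V -> R^o} :=
  [pred f : V -> R^o | `[< linear f /\ continuous f >]].

Record dual := Dual {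
  dual_fun :> V -> R^o;
  dual_funP : dual_fun \in dual_pred }.

HB.instance Definition _ := [isSub for dual_fun].
HB.instance Definition _ := [Choice of dual by <:].

Lemma dual_submod_closed : submod_closed dual_pred.
Proof.
split.
  apply/asboolP; split=> [a u v|]; last exact: cst_continuous.
  by rewrite scaler0 addr0.
move=> a f g /asboolP[lf cf] /asboolP[lg cg]; apply/asboolP; split.
  move=> b u v; rewrite !fctE lf lg !scalerDr !scalerA (mulrC a b).
  by rewrite -!addrA; congr (_ + _); rewrite addrCA.
by move=> x; apply: cvgD; [apply: cvgZl_tmp; exact: cf | exact: cg].
Qed.

HB.instance Definition _ :=
  GRing.isSubmodClosed.Build R (V -> R^o) dual_pred dual_submod_closed.
HB.instance Definition _ := [SubChoice_isSubLmodule of dual by <:].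

Lemma dual_linear (f : dual) : linear f.
Proof. by have /asboolP[] := dual_funP f. Qed.

HB.instance Definition _ (f : dual) :=
  GRing.isLinear.Build R V R^o *:%R (f : V -> R^o) (@dual_linear f).

Lemma dual_continuous (f : dual) : continuous (f : V -> R^o).
Proof. by have /asboolP[] := dual_funP f. Qed.

Lemma dual_ext (f g : dual) : (forall x, f x = g x) -> f = g.
Proof. by move=> fg; apply/val_inj/funext. Qed.

Lemma dualDE (f g : dual) x : (f + g) x = f x + g x. Proof. by []. Qed.
Lemma dualZE (a : R) (f : dual) x : (a *: f) x = a * f x. Proof. by []. Qed.
Lemma dual0E x : (0 : dual) x = 0. Proof. by []. Qed.
Lemma dualNE (f : dual) x : (- f) x = - f x. Proof. by []. Qed.

Definition opnorm (f : dual) : R :=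
  sup [set `|f x| | x in [set x : V | `|x| <= 1]].

Lemma opnorm_has_sup (f : dual) :
  has_sup [set `|f x| | x in [set x : V | `|x| <= 1]].
Proof.
split; first by exists `|f 0|, 0 => //=; rewrite normr0.
have /continuous_linear_bounded/bounded_funP/(_ 1)[M fM] :=
  @dual_continuous f 0.
by exists M => _ [x x1 <-]; exact: fM.
Qed.

Lemma opnorm_ge0 (f : dual) : 0 <= opnorm f.
Proof.
have [_ fub] := opnorm_has_sup f.
apply: (@le_trans _ _ `|f 0|) => //.
by apply: ub_le_sup => //; exists 0 => //=; rewrite normr0.
Qed.

Lemma le_opnorm (f : dual) x : `|f x| <= opnorm f * `|x|.
Proof.
have [->|x0] := eqVneq x 0; first by rewrite linear0 !normr0 mulr0.
have nx0 : 0 < `|x| by rewrite normr_gt0.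
rewrite -ler_pdivrMr//; have [_ fub] := opnorm_has_sup f.
apply: ub_le_sup => //; exists (`|x|^-1 *: x).
  by rewrite /= normfZV.
by rewrite linearZ /= normrM ger0_norm ?invr_ge0// mulrC.
Qed.

Lemma opnorm_le (f : dual) (M : R) :
  (forall x, `|x| <= 1 -> `|f x| <= M) -> opnorm f <= M.
Proof.
move=> fM; apply: ge_sup; first by have [] := opnorm_has_sup f.
by move=> _ [x x1 <-]; exact: fM.
Qed.

Lemma ler_opnormD (f g : dual) : opnorm (f + g) <= opnorm f + opnorm g.
Proof.
apply: opnorm_le => x x1; rewrite dualDE (le_trans (ler_normD _ _))//.
by apply: lerD; rewrite (le_trans (le_opnorm _ _))// ler_piMr// opnorm_ge0.
Qed.

Let opnormZ_le (a : R) (f : dual) : opnorm (a *: f) <= `|a| * opnorm f.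
Proof.
apply: opnorm_le => x x1; rewrite dualZE normrM ler_wpM2l//.
by rewrite (le_trans (le_opnorm _ _))// ler_piMr// opnorm_ge0.
Qed.

Lemma opnormZ (a : R) (f : dual) : opnorm (a *: f) = `|a| * opnorm f.
Proof.
apply/eqP; rewrite eq_le opnormZ_le /=.
have [->|a0] := eqVneq a 0; first by rewrite normr0 mul0r opnorm_ge0.
rewrite -ler_pdivlMl ?normr_gt0// -normfV (le_trans _ (opnormZ_le _ _))//.
by rewrite scalerA mulVf// scale1r.
Qed.

Lemma opnorm0_eq0 (f : dual) : opnorm f = 0 -> f = 0.
Proof.
move=> f0; apply: dual_ext => x; apply/eqP; rewrite -normr_le0.
by rewrite (le_trans (le_opnorm f x))// f0 mul0r.
Qed.

HB.instance Definition _ :=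
  Lmodule_isNormed.Build R dual ler_opnormD opnormZ opnorm0_eq0.

Lemma dual_normE (f : dual) :
  `|f| = sup [set `|f x| | x in [set x : V | `|x| <= 1]].
Proof. by []. Qed.

End DualSpace.

Section Adjoint.
Context (R : realType) (X Y : normedModType R).
Context (A : {linear X -> Y}) (cA : continuous A).

Lemma adjoint_subproof (w : dual Y) : w \o A \in @dual_pred R X.
Proof.
apply/asboolP; split=> [a u v|x] /=.
  by rewrite !linearP.
by apply: continuous_comp; [exact: cA | exact: dual_continuous].
Qed.

Definition adjoint (w : dual Y) : dual X := Dual (adjoint_subproof w).

End Adjoint.

Section ConvexAnalysis.
Context (R : realType) (X : normedModType R).
Implicit Types (f : X -> \bar R) (x : X) (xi : dual X).

(* Meant for functions that never take the value -oo. *)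
Definition convex_ereal f := forall x y (t : R), 0 <= t <= 1 ->
  (f ((t *: x + (1 - t) *: y)%R) <= t%:E * f x + (1 - t)%:E * f y)%E.

Definition coercive f :=
  forall M : R, \forall r \near +oo, forall x, r <= `|x| -> (M%:E <= f x)%E.

Definition argmin f (S : set X) : set X :=
  [set x | S x /\ forall z, S z -> (f x <= f z)%E].

(* Empty at points where f is infinite. *)
Definition subdifferential f x : set (dual X) :=
  [set xi | f x \is a fin_num /\
            forall z, (f x + (xi (z - x))%:E <= f z)%E].

Definition conjugate f xi : \bar R :=
  ereal_sup [set ((xi x)%:E - f x)%E | x in [set: X]].

Definition dual_bregman f x xi xi0 : \bar R :=
  (conjugate f xi - conjugate f xi0 - ((xi - xi0) x)%:E)%E.

End ConvexAnalysis.

(* f is finite and Frechet differentiable near v, and its derivative, as a map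
   into the dual with the operator norm, is Frechet differentiable at v. *)
Definition twice_frechet_differentiable (R : realType) (V : normedModType R)
    (f : V -> \bar R) (v : V) :=
  exists D : V -> dual V,
    [/\ \forall u \near v, f u \is a fin_num,
        \forall u \near v, is_diff u (fine \o f : V -> R^o) (D u)
      & differentiable D v].

Definition is_duality_image (R : realType) (Y : normedModType R) (q : R)
    (w : dual Y) (y : Y) :=
  w y = `|w| * `|y| /\ `|y| = `|w| `^ (q - 1).

(* Only the restriction of Phi to [0, +oo[ matters. *)
Definition index_function (R : realType) (Phi : R -> R) :=
  [/\ {in `[0, +oo[ &, {homo Phi : s t / s < t}},
      {within `[0, +oo[, continuous Phi},
      convex_function (E := R^o) `[0, +oo[%classic (\- Phi),
      Phi 0 = 0
    & forall t, 0 <= t -> 0 <= Phi t].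

Definition comparable_at0 (R : realType) (f g : R -> R) :=
  exists c1 c2 : R, [/\ 0 < c1, c1 <= c2
    & \forall t \near 0^'+, c1 * g t <= f t <= c2 * g t].

(* The hypothesis < +oo makes the inequality vacuous where the dual Bregman
   distance is infinite. *)
Definition dual_variational_inequality (R : realType) (X Y : normedModType R)
    (A : {linear X -> Y}) (cA : continuous A) (Rf : X -> \bar R)
    (xdag : X) (wdag : dual Y) (J : Y) (Phi : R -> R) :=
  forall w : dual Y,
    let D := dual_bregman Rf xdag (adjoint cA w) (adjoint cA wdag) in
    (D < +oo)%E -> (w - wdag) J <= Phi (fine D).

(* Main.v *)
(* Write F for the convex conjugate of the functional and xi0 for the source
   element A^* wdag.  At a point u near xi0, Frechet differentiability of F
   makes the almost maximisers of <u, x> - Rf x converge in norm (Smulian), so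
   the derivatives of F near xi0, and hence the values T h of the second
   derivative at xi0, lie in X although a priori they are in its bidual.
   Moreover
     F (xi0 + t h) - F xi0 - t <h, xdag> = t^2 <h, T h> / 2 + o(t^2),
   and T is symmetric and positive.  Inserting wdag + t w in the variational
   inequality, a bound Phi t <= c sqrt t near 0 gives
   <w, J> <= c (<A^* w, T A^* w> / 2)^(1/2).
   If Phi = o(sqrt), then <w, J> <= 0 for all w; for w = wdag the definition of
   the duality mapping forces wdag = 0, so 0 is a subgradient at xdag.
   In the other case J is bounded with respect to the semi-inner product
   <w, A T A^* v>.  For a minimising sequence w_n of
   <w, A T A^* w> / 2 - <w, J>, the points T A^* w_n form a Cauchy sequence
   in X, and A maps its limit to J. *)
Require Import Defs.
From HB Require Import structures.
From mathcomp Require Import all_boot all_order all_algebra.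
From mathcomp Require Import all_classical all_reals all_analysis.
From mathcomp Require Import ring lra.

Set Implicit Arguments.
Unset Strict Implicit.
Unset Printing Implicit Defensive.

Import Order.TTheory GRing.Theory Num.Theory.
Import numFieldNormedType.Exports.

Local Open Scope classical_set_scope.
Local Open Scope ring_scope.

(** * Norming functionals *)

Section HahnBanach.
Context (R : realType) (V : normedModType R).
Implicit Types (p q : V -> R) (u v y : V).

(** Homogeneity is stated as an inequality for [0 < t]; applied to [t^-1] it gives the reverse
    inequality. *)
Definition sublinear q :=
  (forall u v, q (u + v) <= q u + q v) /\
  (forall t v, 0 < t -> q (t *: v) <= t * q v).

Lemma sublinear0 q : sublinear q -> q 0 = 0.
Proof.
move=> [qD qZ]; have := qD 0 0; have := qZ 2^-1 0.
by rewrite addr0 scaler0 invr_gt0 ltr0n => /(_ isT); lra.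
Qed.

Lemma sublinearZ q t v : sublinear q -> 0 <= t -> q (t *: v) = t * q v.
Proof.
move=> sq; rewrite le_eqVlt => /predU1P[<-|t0].
  by rewrite scale0r mul0r sublinear0.
have [_ qZ] := sq; apply/le_anti; rewrite qZ//=.
rewrite -ler_pdivlMl//; have := qZ t^-1 (t *: v).
by rewrite scalerA mulVf ?gt_eqF// scale1r invr_gt0 => ->.
Qed.

Lemma sublinear_ge_opp q v : sublinear q -> - q (- v) <= q v.
Proof.
move=> sq; have := sq.1 v (- v).
by rewrite subrr sublinear0// => ?; lra.
Qed.

(* A sublinear functional below [q] which is linear along the line spanned by
   [y]; a minimal sublinear functional equals all its tilts, hence is linear. *)
Definition tilt q y v := inf [set q (v + t *: y) - t * q y | t in [set t | 0 <= t]].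

(** Subadditivity at [v + t *: y] and [- v] gives a bound independent of [t], so the infimum in
    [tilt] is a genuine one. *)
Lemma tilt_lb q y v : sublinear q ->
  lbound [set q (v + t *: y) - t * q y | t in [set t | 0 <= t]] (- q (- v)).
Proof.
move=> sq _ [t t0 <-]; rewrite -sublinearZ//.
by have := sq.1 (v + t *: y) (- v); rewrite [_ + - v]addrC addKr; lra.
Qed.

Lemma tilt_le_at q y v t : sublinear q -> 0 <= t ->
  tilt q y v <= q (v + t *: y) - t * q y.
Proof.
move=> sq t0; apply: ge_inf; first by exists (- q (- v)); exact: tilt_lb.
by exists t.
Qed.

Lemma tilt_ge q y v m : sublinear q ->
  (forall t, 0 <= t -> m <= q (v + t *: y) - t * q y) -> m <= tilt q y v.
Proof.
move=> sq mq; apply: lb_le_inf; first by exists (q (v + 0 *: y) - 0 * q y), 0 => //=.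
by move=> _ [t t0 <-]; exact: mq.
Qed.

Lemma tilt_le q y v : sublinear q -> tilt q y v <= q v.
Proof.
by move=> sq; rewrite (le_trans (tilt_le_at y v sq (lexx 0)))// scale0r addr0 mul0r subr0.
Qed.

Lemma tiltN_le q y : sublinear q -> tilt q y (- y) <= - q y.
Proof.
move=> sq; rewrite (le_trans (tilt_le_at y (- y) sq ler01))//.
by rewrite scale1r addNr sublinear0// mul1r add0r.
Qed.

(** Parameters [s] for [u] and [t] for [v] combine to the admissible parameter [s + t] for [u + v];
    homogeneity rescales the parameter. *)
Lemma tilt_sublinear q y : sublinear q -> sublinear (tilt q y).
Proof.
move=> sq; split=> [u v|t v t0].
  rewrite -lerBlDl; apply: tilt_ge => // t t0.
  rewrite lerBlDl -lerBlDr; apply: tilt_ge => // s s0.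
  have := tilt_le_at y (u + v) sq (addr_ge0 s0 t0).
  have := sq.1 (u + s *: y) (v + t *: y).
  by rewrite addrACA -scalerDl; lra.
rewrite -ler_pdivrMl//; apply: tilt_ge => // s s0.
have := tilt_le_at y (t *: v) sq (mulr_ge0 (ltW t0) s0).
rewrite ler_pdivrMl// -scalerA -scalerDr (sublinearZ _ sq (ltW t0)).
by rewrite mulrBr mulrA.
Qed.

(** Zorn's lemma for the reversed pointwise order. A chain is bounded by its pointwise infimum,
    which is finite because every member is at least [- p (- v)] at [v]. *)
Lemma minimal_sublinear_exists p : sublinear p ->
  exists q, [/\ sublinear q, forall v, q v <= p v &
    forall r, sublinear r -> (forall v, r v <= q v) -> r = q].
Proof.
move=> sp.
pose T := {q : V -> R | sublinear q /\ forall v, q v <= p v}.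
pose below (q r : T) := `[< forall v, sval r v <= sval q v >].
have T0 : T by exists p; split.
have [||||[q [sq qp]] qmin] := @Zorn T below.
- by move=> q; apply/asboolP.
- move=> q r s /asboolP rq /asboolP sr; apply/asboolP => v.
  exact: le_trans (sr v) (rq v).
- move=> [q hq] [r hr] /asboolP/= rq /asboolP/= qr; apply: eq_exist => /=.
  by apply/funext => v; apply/le_anti; rewrite qr rq.
- move=> A Atot; have [[a Aa]|A0] := pselect (A !=set0); last first.
    by exists T0 => s As; exfalso; apply: A0; exists s.
  pose E v := [set sval s v | s in A].
  have Elb v : lbound (E v) (- p (- v)).
    move=> _ [[s [ss sp']] _ <-] /=; apply: le_trans (sublinear_ge_opp v ss).
    by rewrite lerN2.
  have infle s v : A s -> inf (E v) <= sval s v.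
    by move=> As; apply: ge_inf; [exists (- p (- v)); exact: Elb | exists s].
  have leinf m v : (forall s, A s -> m <= sval s v) -> m <= inf (E v).
    move=> mA; apply: lb_le_inf; first by exists (sval a v), a.
    by move=> _ [s As <-]; exact: mA.
  have sinf : sublinear (fun v => inf (E v)) /\ forall v, inf (E v) <= p v.
    split; last by move=> v; apply: le_trans (infle _ _ Aa) _; case: (svalP a).
    split=> [u v|t v t0].
      rewrite -lerBlDl; apply: (leinf) => s As.
      rewrite lerBlDl -lerBlDr; apply: (leinf) => r Ar; rewrite lerBlDr.
      (* Two members of the chain are comparable, and the smaller one serves at both [u] and [v]. *)
      have [/asboolP sr|/asboolP rs] := Atot _ _ As Ar.
        apply: le_trans (infle _ _ Ar) _; apply: le_trans ((svalP r).1.1 u v) _.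
        by rewrite lerD2l.
      apply: le_trans (infle _ _ As) _; apply: le_trans ((svalP s).1.1 u v) _.
      by rewrite lerD2r.
    rewrite -ler_pdivrMl//; apply: (leinf) => s As; rewrite ler_pdivrMl//.
    exact: le_trans (infle _ _ As) ((svalP s).1.2 t v t0).
  exists (exist _ _ sinf : T) => s As; apply/asboolP => v /=.
  exact: infle.
exists q; split=> // r sr rq.
have hr : sublinear r /\ forall v, r v <= p v.
  by split=> // v; exact: le_trans (rq v) (qp v).
have := qmin (exist _ r hr : T); rewrite /below /= => /(_ _).
by move=> /(_ (asboolT rq)) /(congr1 sval).
Qed.

Lemma norm_sublinear : sublinear (fun v : V => `|v|).
Proof.
split=> [u v|t v t0]; first exact: ler_normD.
by rewrite normrZ gtr0_norm.
Qed.

(** Zorn's lemma starts from the norm tilted along [x]: this forces [q (- x) <= - |x|], so the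
    minimal functional, being linear, attains the norm at [x]. *)
Lemma norming_functional x : exists f : dual V, `|f| <= 1 /\ f x = `|x|.
Proof.
have [q [sq qle qmin]] :=
  @minimal_sublinear_exists _ (tilt_sublinear x norm_sublinear).
have qn v : q v <= `|v|.
  by rewrite (le_trans (qle v))// (tilt_le x v norm_sublinear).
have qN v : q (- v) = - q v.
  have tq : tilt q v = q.
    by apply: qmin => [|w]; [exact: tilt_sublinear | exact: tilt_le].
  have := tiltN_le v sq; have := sublinear_ge_opp v sq.
  by rewrite tq => ? ?; apply/le_anti/andP; split => //; lra.
have qlin : linear (q : V -> R^o).
  have qD u v : q (u + v) = q u + q v.
    apply/le_anti; rewrite sq.1/=.
    by have := sq.1 (u + v) (- v); rewrite addrK qN; lra.
  move=> a u v; rewrite qD; congr (_ + _).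
  have [a0|/ltW a0] := leP 0 a; first exact: sublinearZ.
  by rewrite -[in LHS](opprK a) scaleNr qN sublinearZ ?oppr_ge0// -mulNr opprK.
pose ql := GRing.isLinear.Build R V R^o *:%R (q : V -> R^o) qlin.
pose f : {linear V -> R^o} := HB.pack (q : V -> R^o) ql.
have qabs v : `|q v| <= `|v|.
  by rewrite ler_norml qn andbT -[`|v|]normrN lerNl -qN.
have cq : continuous f.
  apply/linear_bounded_continuous/linear_boundedP.
  near=> r => v; apply: le_trans (qabs v) _; apply: ler_peMl => //.
have qd : (q : V -> R^o) \in @dual_pred R V by apply/asboolP; split.
exists (Dual qd); split.
  by apply: opnorm_le => v v1; rewrite (le_trans (qabs v)).
rewrite /=; apply/le_anti; rewrite qn/= -lerN2 -qN.
by rewrite (le_trans (qle _))// (tiltN_le x norm_sublinear).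
Unshelve. all: by end_near. Qed.

(** The embedding into the bidual is isometric; this turns estimates uniform in the functional into
    norm estimates in [V]. *)
Lemma norm_le_dual (x : V) (M : R) : 0 <= M ->
  (forall f : dual V, `|f x| <= M * `|f|) -> `|x| <= M.
Proof.
move=> M0 xM; have [f [f1 fx]] := norming_functional x.
have := xM f; rewrite fx normr_id => /le_trans; apply.
by rewrite ler_piMr.
Qed.

Lemma dual_separates (x y : V) : (forall f : dual V, f x = f y) -> x = y.
Proof.
move=> xy; apply/eqP; rewrite -subr_eq0 -normr_le0.
by apply: norm_le_dual => // f; rewrite linearB/= xy subrr normr0 mul0r.
Qed.

End HahnBanach.

(** * Derivatives of a conjugate *)

Lemma is_diff_near (R : realType) (V W : normedModType R) (g dg : V -> W) (u : V) :
  is_diff u g dg -> forall e, 0 < e ->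
  \forall h \near 0, `|g (h + u) - g u - dg h| <= e * `|h|.
Proof.
move=> dgu e e0; have /diff_locally/eqaddoP/(_ _ e0) := @ex_diff _ _ _ _ _ _ _ dgu.
rewrite (@diff_val _ _ _ _ _ _ _ dgu); apply: filterS => h /=.
by rewrite -[X in `|X|]/(g (h + u) - (g u + dg h)) opprD addrA.
Qed.

Lemma nbhs0_ball (R : realType) (V : normedModType R) (P : V -> Prop) :
  (\forall h \near 0, P h) -> exists2 r : R, 0 < r & forall h, `|h| <= r -> P h.
Proof.
move=> /nbhs_norm0P[r /= r0 rP]; exists (r / 2); first by rewrite divr_gt0.
by move=> h hr; apply: rP; rewrite /= (le_lt_trans hr)// ltr_pdivrMr// ltr_pMr// ltr1n.
Qed.

(** Used to pass to all directions from a sphere of fixed radius, on which a constant error can be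
    absorbed into a multiple of [r]. *)
Lemma poshom_le (R : realType) (V : normedModType R) (phi : V -> R) (r c : R) :
  0 < r -> (forall t v, 0 <= t -> phi (t *: v) = t * phi v) ->
  (forall v, `|v| = r -> phi v <= c * r) -> forall v, phi v <= c * `|v|.
Proof.
move=> r0 phiZ phir v; have [->|v0] := eqVneq v 0.
  by rewrite normr0 mulr0 -(scale0r 0) phiZ// mul0r.
have nv0 : 0 < `|v| by rewrite normr_gt0.
have rv0 : 0 < r / `|v| by rewrite divr_gt0.
have := phir ((r / `|v|) *: v).
rewrite normrZ gtr0_norm// divfK ?gt_eqF// (phiZ _ _ (ltW rv0)) => /(_ erefl).
rewrite -ler_pdivlMl// => /le_trans; apply.
by rewrite le_eqVlt; apply/orP; left; apply/eqP; field; rewrite !gt_eqF.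
Qed.

Section Representation.
Context (R : realType) (X : completeNormedModType R).

Lemma cvg_of_dist_le (u : nat -> X) (e : nat -> R) : e @ \oo --> 0 ->
  (forall n m, `|u n - u m| <= e n + e m) -> cvg (u @ \oo).
Proof.
move=> e0 ue; apply/cauchy_cvgP/cauchy_exP => _/posnumP[eps].
have e2 : \forall n \near \oo, e n < eps%:num / 2.
  by apply: (cvgr_lt 0 e0); rewrite divr_gt0.
have [N _ eN] := e2; exists (u N).
change (\forall n \near \oo, ball (u N) eps%:num (u n)); near=> n.
rewrite -ball_normE /=; apply: le_lt_trans (ue _ _) _.
by rewrite [ltRHS]splitr ltrD//; [exact: (eN N (leqnn N))|near: n].
Unshelve. all: by end_near. Qed.

(** A complete space is closed in its bidual: points whose evaluations approximate [L] form a Cauchy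
    sequence, and its limit represents [L]. *)
Lemma approx_eval (L : dual X -> R) :
  (forall e, 0 < e -> exists x, forall h : dual X, `|L h - h x| <= e * `|h|) ->
  exists x, forall h, L h = h x.
Proof.
move=> Lx; have /choice[u uP] : forall n, exists x, forall h : dual X,
    `|L h - h x| <= n.+1%:R^-1 * `|h|.
  by move=> n; apply: Lx; rewrite invr_gt0 ltr0n.
have e0 : n.+1%:R^-1 @[n --> \oo] --> (0 : R) by exact: cvg_harmonic.
have /cvg_ex[x ux] : cvg (u @ \oo).
  apply: (cvg_of_dist_le e0) => n m; apply: norm_le_dual.
    by rewrite addr_ge0// invr_ge0.
  move=> h; rewrite linearB/= mulrDl (distrC (h (u n))).
  rewrite (_ : _ - _ = (L h - h (u n)) - (L h - h (u m))); last by ring.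
  by rewrite (le_trans (ler_normB _ _))// lerD.
exists x => h.
have h1 : h (u n) @[n --> \oo] --> h x.
  by apply: continuous_cvg ux; exact: dual_continuous.
have h2 : h (u n) @[n --> \oo] --> L h.
  apply/subr_cvg0; apply: norm_cvg0.
  apply: (squeeze_cvgr _ (cvg_cst 0)).
    near=> n; rewrite normr_ge0/= distrC; exact: (uP n h).
  by rewrite -[X in _ --> X](mul0r `|h|); apply: cvgMl.
by have := cvg_unique _ h2 h1; apply.
Unshelve. all: by end_near. Qed.

End Representation.

Section Conjugate.
Context (R : realType) (X : completeNormedModType R) (Rf : X -> \bar R).
Hypothesis Rf_ge0 : forall x, (0 <= Rf x)%E.
Local Notation F := (conjugate Rf).

Lemma conjugate_ge (v : dual X) z : ((v z)%:E - Rf z <= F v)%E.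
Proof. by apply: ereal_sup_ubound; exists z. Qed.

(** An almost maximiser [z] of the supremum defining [F u] works, since [v z - Rf z] is an affine
    minorant of [F] in [v]. *)
Lemma conjugate_eps_subgradient (u : dual X) (e : R) :
  F u \is a fin_num -> 0 < e ->
  exists z, forall v : dual X, (F u + ((v - u) z - e)%:E <= F v)%E.
Proof.
move=> Fu e0; have [_ [z _ <-]] := ub_ereal_sup_adherent e0 Fu.
rewrite -/(F u) => uz; exists z => v.
apply: le_trans (conjugate_ge v z).
move: uz (Rf_ge0 z); rewrite -(fineK Fu); case: (Rf z) => // r.
  rewrite -!EFinN -!EFinD lte_fin lee_fin => ? _; rewrite lee_fin.
  by rewrite dualDE dualNE; lra.
Qed.

Lemma conjugate_diff_approx (u : dual X) (Du : dual (dual X)) :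
  (\forall v \near u, F v \is a fin_num) ->
  is_diff u (fine \o F : dual X -> R^o) Du -> forall e, 0 < e ->
  exists z, (forall h : dual X, `|Du h - h z| <= e * `|h|) /\
            (forall v : dual X, (F u + ((v - u) z - e)%:E <= F v)%E).
Proof.
move=> Ffin dFu e e0; have Fu : F u \is a fin_num by exact: nbhs_singleton Ffin.
have e20 : 0 < e / 2 by rewrite divr_gt0.
have Fuh : \forall h \near (0 : dual X), F (h + u) \is a fin_num.
  by move/nbhs0P: Ffin; apply: filterS => h; rewrite addrC.
have [r r0 Pr] := nbhs0_ball (filterI (is_diff_near dFu e20) Fuh).
(* On the sphere of radius [r] the differentiability remainder and the subgradient error are each at
   most [e / 2 * r]; the bound [e] serves the second conclusion. *)
have m0 : 0 < Num.min e (e / 2 * r) by rewrite lt_min e0 mulr_gt0.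
have [z zP] := conjugate_eps_subgradient Fu m0.
exists z; split; last first.
  move=> v; apply: le_trans (zP v); rewrite leeD2l// lee_fin lerD2l lerN2.
  by rewrite ge_min lexx.
have half (h : dual X) : `|h| = r -> h z - Du h <= e * r.
  move=> hr; have [] := Pr h; rewrite ?hr//= => + Fh.
  rewrite ler_norml => /andP[_].
  have := zP (h + u); rewrite addrK -(fineK Fu) -(fineK Fh) -EFinD lee_fin.
  have : Num.min e (e / 2 * r) <= e / 2 * r by rewrite ge_min lexx orbT.
  lra.
have full : forall h : dual X, h z - Du h <= e * `|h|.
  by apply: (poshom_le r0) half => t h t0; rewrite linearZ dualZE/= mulrBr.
move=> h; rewrite ler_norml; apply/andP; split; first by have := full h; lra.
by have := full (- h); rewrite linearN dualNE normrN/=; lra.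
Qed.

(* Smulian: at a point of Frechet differentiability of the conjugate the
   almost maximisers of the supremum defining it converge in norm, so that the
   derivative lies in [X] and not only in its bidual. *)
Lemma conjugate_diff_repr (u : dual X) (Du : dual (dual X)) :
  (\forall v \near u, F v \is a fin_num) ->
  is_diff u (fine \o F : dual X -> R^o) Du ->
  exists x, (forall h : dual X, Du h = h x) /\
            (forall v : dual X, (F u + ((v - u) x)%:E <= F v)%E).
Proof.
move=> Ffin dFu; have approx := conjugate_diff_approx Ffin dFu.
have Fu : F u \is a fin_num by exact: nbhs_singleton Ffin.
have [x Dux] : exists x, forall h : dual X, Du h = h x.
  by apply: approx_eval => e /approx[z [zP _]]; exists z.
exists x; split=> // v; apply/lee_addgt0Pr => e e0.
(* Replacing [z] by [x] costs [d * |v - u|] and the approximate subgradient inequality costs [d];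
   together they make [e]. *)
pose d := e / (1 + `|v - u|).
have n0 : 0 < 1 + `|v - u| by rewrite ltr_pwDl.
have [|z [zD zv]] := approx d; first by rewrite divr_gt0.
rewrite -leeBlDr//; apply: le_trans (zv v).
rewrite -addeA leeD2l// -EFinN -EFinD lee_fin.
have := zD (v - u); rewrite Dux ler_norml => /andP[_].
have : d * (1 + `|v - u|) = e by rewrite divfK// gt_eqF.
lra.
Qed.

End Conjugate.

(** * Second-order expansion *)

Lemma discriminant_le (R : realFieldType) (a b c : R) : 0 <= a ->
  (forall s, 0 <= c + s * b + s ^+ 2 * a) -> b ^+ 2 <= 4 * c * a.
Proof.
rewrite le_eqVlt => /predU1P[<-|a0] pos.
  rewrite mulr0 leNgt; apply/negP => b2.
  have b0 : b != 0 by rewrite -sqrf_eq0 gt_eqF.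
  by have := pos (- (c + 1) / b); rewrite divfK// mulr0; lra.
have := pos (- b / (2 * a)).
have -> : c + - b / (2 * a) * b + (- b / (2 * a)) ^+ 2 * a = (4 * c * a - b ^+ 2) / (4 * a).
  by field; rewrite gt_eqF.
by rewrite pmulr_lge0 ?invr_gt0 ?mulr_gt0// subr_ge0.
Qed.

Section SecondOrder.
Context (R : realType) (X : completeNormedModType R) (F : dual X -> \bar R).
Local Notation f := (fine \o F : dual X -> R^o).
Context (xi0 : dual X) (x0 : X) (D : dual X -> dual (dual X)).
Hypothesis Ffin : \forall u \near xi0, F u \is a fin_num.
Hypothesis FD : \forall u \near xi0, is_diff u f (D u).
Hypothesis derivative_repr_near : \forall u \near xi0,
  exists x, (forall h : dual X, D u h = h x) /\
            (forall v : dual X, (F u + ((v - u) x)%:E <= F v)%E).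
Context (T : {linear dual X -> dual (dual X)}).
Hypothesis DT : is_diff xi0 D T.
Hypothesis x0_sub : forall v : dual X, (F xi0 + ((v - xi0) x0)%:E <= F v)%E.
Implicit Types h k : dual X.

Let TZ t h : T (t *: h) = t *: T h. Proof. by rewrite linearZ_LR. Qed.
Let TD h k : T (h + k) = T h + T k. Proof. by rewrite linearD. Qed.

(** A subgradient at a point of differentiability is unique: comparing its inequality with the
    first-order expansion on small spheres bounds [k (x0 - y)] by any positive multiple of [|k|]. *)
Lemma derivative_at_subgradient h : D xi0 h = h x0.
Proof.
have [y [Dy _]] := nbhs_singleton derivative_repr_near.
suff le0 k : k (x0 - y) <= 0.
  rewrite Dy; have := le0 h; have := le0 (- h); rewrite dualNE.
  by rewrite !linearB/= => ? ?; apply/le_anti/andP; split; lra.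
rewrite -[leRHS](mul0r `|k|); apply/ler_addgt0Pr => e e0.
pose d := e / (1 + `|k|).
have n0 : 0 < 1 + `|k| by rewrite ltr_pwDl.
have d0 : 0 < d by rewrite divr_gt0.
have Fk : \forall h \near (0 : dual X), F (h + xi0) \is a fin_num.
  by move/nbhs0P: Ffin; apply: filterS => z; rewrite addrC.
have [r r0 rP] := nbhs0_ball (filterI (is_diff_near (nbhs_singleton FD) d0) Fk).
have hom t v : 0 <= t -> (t *: v : dual X) (x0 - y) = t * v (x0 - y) by [].
have := @poshom_le _ _ (fun v : dual X => v (x0 - y)) r d r0 hom _ k.
have -> : 0 * `|k| + e = d * `|k| + d.
  by rewrite mul0r add0r -{2}[d]mulr1 -mulrDr addrC divfK// gt_eqF.
move=> le; apply: le_trans (le _) _; last by rewrite lerDl ltW.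
move=> v vr; have [] := rP v; rewrite ?vr// => + Fv.
rewrite Dy ler_norml => /andP[_].
have Fxi := nbhs_singleton Ffin.
have := x0_sub (v + xi0); rewrite addrK -(fineK Fxi) -(fineK Fv) -EFinD lee_fin.
by rewrite linearB/=; lra.
Qed.

(** When [F] is a conjugate, this is the dual Bregman distance from [xi0] to [t *: h + xi0],
    wherever [F] is finite. *)
Definition taylor1 h t : R := f (t *: h + xi0) - f xi0 - t * h x0.

Lemma line_cvg0 h : t *: h + xi0 @[t --> (0 : R)] --> xi0.
Proof.
rewrite -[X in _ --> X]add0r -(scale0r h); apply: cvgD; last exact: cvg_cst.
exact: (cvgZr_tmp cvg_id).
Qed.

Lemma line_near h (P : dual X -> Prop) : (\forall u \near xi0, P u) ->
  \forall t \near 0^'+, P (t *: h + xi0).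
Proof. by move=> Pu; apply: cvg_within; exact: (line_cvg0 h Pu). Qed.

Lemma second_diff_near h (e : R) : 0 < e -> \forall t \near (0 : R),
  forall k, `|D (t *: h + xi0) k - k x0 - t * T h k| <= e * `|t| * `|k|.
Proof.
move=> e0; have e10 : 0 < e / (1 + `|h|) by rewrite divr_gt0// ltr_pwDl.
have h0 : t *: h @[t --> (0 : R)] --> (0 : dual X).
  by rewrite -(scale0r h); exact: (cvgZr_tmp cvg_id).
have : \forall t \near (0 : R), `|D (t *: h + xi0) - D xi0 - T (t *: h)| <=
    e / (1 + `|h|) * `|t *: h|.
  exact: (h0 _ (is_diff_near DT e10)).
apply: filterS => t th k.
rewrite -derivative_at_subgradient.
have -> : D (t *: h + xi0) k - D xi0 k - t * T h k =
          (D (t *: h + xi0) - D xi0 - T (t *: h)) k.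
  by rewrite !dualDE !dualNE TZ.
apply: (le_trans (le_opnorm _ k)); rewrite ler_wpM2r//.
apply: le_trans th _; rewrite normrZ.
rewrite (_ : _ * _ = e * `|t| * (`|h| / (1 + `|h|))); last by ring.
rewrite ler_piMr ?mulr_ge0 ?(ltW e0)// ler_pdivrMr ?ltr_pwDl//.
by rewrite mul1r lerDr.
Qed.

Lemma is_derive_line h t : is_diff (t *: h + xi0) f (D (t *: h + xi0)) ->
  is_derive t 1 (fun s => f (s *: h + xi0)) (D (t *: h + xi0) h).
Proof.
move=> dft; have dv := @diff_derivable _ _ _ f _ h (@ex_diff _ _ _ _ _ _ _ dft).
have E : (fun s : R => s^-1 *:
      (((fun s => f (s *: h + xi0)) \o shift t) (s *: 1) - f (t *: h + xi0))) =
    (fun s : R => s^-1 *: ((f \o shift (t *: h + xi0)) (s *: h) - f (t *: h + xi0))).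
  by apply/funext => s; rewrite /= -[s *: 1]/(s * 1) mulr1 scalerDl addrA.
split; first by rewrite /derivable E.
rewrite /derive E -[LHS]/(derive f (t *: h + xi0) h).
by rewrite deriveE ?(@diff_val _ _ _ _ _ _ _ dft)//; exact: (@ex_diff _ _ _ _ _ _ _ dft).
Qed.

(** [D] is known to be differentiable at [xi0] only, so the mean value theorem is applied once, to
    the difference of [taylor1] and its quadratic model; the derivative of that difference at [s] is
    at most [e * s]. *)
Lemma taylor2 h (e : R) : 0 < e ->
  \forall t \near 0^'+, `|taylor1 h t - t ^+ 2 * (T h h / 2)| <= e * t ^+ 2.
Proof.
move=> e0; have e10 : 0 < e / (1 + `|h|) by rewrite divr_gt0// ltr_pwDl.
have dline : \forall t \near (0 : R), is_diff (t *: h + xi0) f (D (t *: h + xi0)).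
  exact: (line_cvg0 h FD).
have [r r0 rP] := nbhs0_ball (filterI dline (second_diff_near h e10)).
near=> t.
have t0 : 0 < t by [].
have tr : t <= r by near: t; exact: nbhs_right_le.
pose phi (s : R) : R := taylor1 h s - s ^+ 2 * (T h h / 2).
pose dphi (s : R) : R := D (s *: h + xi0) h - h x0 - s * T h h.
have dP s : 0 <= s <= t -> is_derive s 1 phi (dphi s).
  move=> /andP[s0 st]; have [|ds _] := rP s; first by rewrite ger0_norm// (le_trans st).
  have dl := is_derive_line ds.
  have -> : phi = (fun s => f (s *: h + xi0)) - cst (f xi0) - (h x0 \*: id)
      - ((T h h / 2) \*: (id ^+ 2)).
    by apply/funext => z; rewrite /phi /taylor1 !fctE/= (mulrC z) (mulrC (z ^+ 2)).
  apply: is_derive_eq; rewrite /dphi subr0.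
  rewrite -[_ *: 1 in LHS]/(_ * 1) mulr1; congr (_ - _).
  by rewrite -[LHS]/(_ * (_ * 1)) /= expr1; field.
have phic : {within `[0, t], continuous phi}.
  apply: derivable_within_continuous => s.
  by rewrite in_itv/= => /dP ds; exact: ex_derive.
have phid s : s \in `]0, t[%R -> is_derive s 1 phi (dphi s).
  by rewrite in_itv/= => /andP[/ltW s0 /ltW st]; apply: dP; rewrite s0.
have [c] := MVT t0 phid phic.
rewrite in_itv/= => /andP[c0 ct].
have phi0 : phi 0 = 0.
  by rewrite /phi /taylor1 scale0r add0r subrr expr0n/= !mul0r !subr0.
rewrite phi0 !subr0 -/(phi t) => ->; rewrite normrM (gtr0_norm t0) expr2 mulrA ler_pM2r//.
have [|_ /(_ h)] := rP c; first by rewrite gtr0_norm// (le_trans (ltW ct)).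
move/le_trans; apply; rewrite gtr0_norm//.
rewrite (_ : _ * _ = e * c * (`|h| / (1 + `|h|))); last by ring.
apply: (@le_trans _ _ (e * c)); last by rewrite ler_pM2l// ltW.
rewrite ler_piMr ?mulr_ge0 ?(ltW e0) ?(ltW c0)// ler_pdivrMr ?ltr_pwDl//.
by rewrite mul1r lerDr.
Unshelve. all: by end_near. Qed.

(** The subgradient inequality at [t *: h + xi0], tested at [t *: h' + xi0]. *)
Lemma taylor1_increment_ge h h' : \forall t \near 0^'+,
  t * (D (t *: h + xi0) (h' - h) - (h' - h) x0) <= taylor1 h' t - taylor1 h t.
Proof.
have H1 := line_near h derivative_repr_near.
have H2 := line_near h Ffin; have H3 := line_near h' Ffin.
apply: filterS3 H1 H2 H3 => t [x [Dx xsub]] F1 F2.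
have := xsub (t *: h' + xi0).
have -> : t *: h' + xi0 - (t *: h + xi0) = t *: (h' - h).
  by rewrite scalerBr opprD addrACA subrr addr0.
have -> : (t *: (h' - h)) x = t * (h' x - h x) by [].
rewrite -(fineK F1) -(fineK F2) -EFinD lee_fin Dx.
have -> : (h' - h) x = h' x - h x by [].
have -> : (h' - h) x0 = h' x0 - h x0 by [].
by rewrite /taylor1 /=; lra.
Qed.

(** Dividing the increment inequality by [t ^+ 2] and letting [t] tend to 0 shows that [T h] is a
    subgradient at [h] of the quadratic form [T h h / 2]. *)
Lemma second_derivative_subgradient h k (s : R) :
  s * T h k <= T (h + s *: k) (h + s *: k) / 2 - T h h / 2.
Proof.
set h' := h + s *: k; set a := _ / 2; set b := T h h / 2.
apply/ler_addgt0Pr => d d0.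
(* Two Taylor remainders contribute [2], and the expansion of [D] along [s *: k] contributes the
   rest. *)
pose n : R := 2 + `|s| * `|k|; have n0 : 0 < n by rewrite ltr_pwDl// mulr_ge0.
pose e := d / n; have e0 : 0 < e by rewrite divr_gt0.
have -> : d = e * n by rewrite divfK// gt_eqF.
near (0 : R)^'+ => t; have t0 : 0 < t by [].
have ta : `|taylor1 h' t - t ^+ 2 * a| <= e * t ^+ 2.
  by near: t; exact: taylor2.
have tb : `|taylor1 h t - t ^+ 2 * b| <= e * t ^+ 2 by near: t; exact: taylor2.
have tc : forall k, `|D (t *: h + xi0) k - k x0 - t * T h k| <= e * `|t| * `|k|.
  by near: t; apply: cvg_within; exact: second_diff_near.
have td : t * (s * (D (t *: h + xi0) k - k x0)) <= taylor1 h' t - taylor1 h t.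
  suff : t * (D (t *: h + xi0) (h' - h) - (h' - h) x0) <= taylor1 h' t - taylor1 h t.
    have -> : h' - h = s *: k by rewrite /h' addrAC subrr add0r.
    have -> : D (t *: h + xi0) (s *: k) = s * D (t *: h + xi0) k.
      exact: linearZ_LR.
    by have -> : (s *: k) x0 = s * k x0; rewrite ?mulrBr.
  by near: t; exact: taylor1_increment_ge.
have te : - (e * t * (`|s| * `|k|)) <= s * (D (t *: h + xi0) k - k x0 - t * T h k).
  rewrite lerNl (le_trans (ler_norm _))// normrN normrM mulrCA ler_wpM2l//.
  by rewrite (le_trans (tc k))// gtr0_norm.
rewrite -(ler_pM2l (exprn_gt0 2 t0)).
move: ta tb; rewrite !ler_norml => /andP[_ ta] /andP[tb _].
rewrite -(ler_pM2l t0) in te.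
rewrite /n; move: ta tb te td; rewrite !expr2; lra.
Unshelve. all: by end_near. Qed.

Lemma second_derivative_ge0 h : 0 <= T h h.
Proof.
have := second_derivative_subgradient 0 h 1.
have -> : T 0 = 0 by rewrite linear0.
by rewrite scale1r add0r !dual0E; lra.
Qed.

(** Expanding the subgradient inequality along [h + s *: k] leaves [0 <= s * (T k h - T h k) + s ^+
    2 * T k k] for all [s], so the linear coefficient vanishes. *)
Lemma second_derivative_sym h k : T h k = T k h.
Proof.
suff : (T k h - T h k) ^+ 2 <= 4 * 0 * T k k.
  by rewrite mulr0 mul0r real_exprn_even_le0 ?num_real//= subr_eq0 => /eqP.
apply: discriminant_le => [|s]; first exact: second_derivative_ge0.
have := second_derivative_subgradient h k s.
have -> : T (h + s *: k) = T h + s *: T k by rewrite TD TZ.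
have -> : (T h + s *: T k) (h + s *: k) =
    T h (h + s *: k) + s * T k (h + s *: k) by [].
have E (g : dual (dual X)) : g (h + s *: k) = g h + s * g k.
  by rewrite linearD; congr (_ + _); exact: linearZ_LR.
by rewrite !E; lra.
Qed.

Lemma taylor1_bounds h (e : R) : 0 < e -> \forall t \near 0^'+,
  [/\ F (t *: h + xi0) \is a fin_num, 0 <= taylor1 h t
    & taylor1 h t <= t ^+ 2 * (T h h / 2 + e)].
Proof.
move=> e0; near=> t.
have F1 : F (t *: h + xi0) \is a fin_num by near: t; exact: (line_near h Ffin).
split=> //.
  have := x0_sub (t *: h + xi0); rewrite addrK -(fineK F1).
  have -> : (t *: h) x0 = t * h x0 by [].
  by rewrite -(fineK (nbhs_singleton Ffin)) -EFinD lee_fin /taylor1/=; lra.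
have : `|taylor1 h t - t ^+ 2 * (T h h / 2)| <= e * t ^+ 2.
  by near: t; exact: taylor2.
by rewrite ler_norml => /andP[_]; lra.
Unshelve. all: by end_near. Qed.

(** The difference quotients of [D] along [h] are evaluations at points of [X] and converge to [T h]
    uniformly on bounded sets of [k]. *)
Lemma second_derivative_repr h : exists x, forall k, T h k = k x.
Proof.
apply: approx_eval => e e0; near (0 : R)^'+ => t; have t0 : 0 < t by [].
have [x [Dx _]] : exists x, (forall k, D (t *: h + xi0) k = k x) /\
   (forall v : dual X, (F (t *: h + xi0)%R + ((v - (t *: h + xi0)) x)%R%:E <= F v)%E).
  by near: t; exact: (line_near h derivative_repr_near).
have tc : forall k, `|D (t *: h + xi0) k - k x0 - t * T h k| <= e * `|t| * `|k|.
  by near: t; apply: cvg_within; exact: second_diff_near.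
exists (t^-1 *: (x - x0)) => k.
rewrite linearZ_LR linearB/= -Dx -[_ *: _]/(_ * _) -(ler_pM2l t0) -{1}(gtr0_norm t0) -normrM.
have := tc k; rewrite distrC (gtr0_norm t0) mulrBr mulVKf ?gt_eqF//.
by rewrite mulrCA mulrA.
Unshelve. all: by end_near. Qed.

End SecondOrder.

(** * Range of a factored quadratic form *)

(** The [u n] almost minimise [Q]. As [B] may be degenerate, they are controlled only in its
    seminorm; the second bound is an approximate Euler equation. *)
Lemma quadratic_minimising_sequence (R : realType) (E : lmodType R)
    (B : E -> E -> R) (l : E -> R) (K : R) (e : nat -> R) :
  (forall u v, B u v = B v u) ->
  (forall u s v w, B (u + s *: v) w = B u w + s * B v w) ->
  (forall u, 0 <= B u u) ->
  (forall u s v, l (u + s *: v) = l u + s * l v) ->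
  0 <= K -> (forall u, l u ^+ 2 <= K * B u u) -> (forall n, 0 < e n) ->
  exists u : nat -> E,
    (forall n m, B (u n - u m) (u n - u m) <= 4 * (e n + e m)) /\
    (forall n v, (B (u n) v - l v) ^+ 2 <= 2 * e n * B v v).
Proof.
move=> Bsym Blin Bge0 llin K0 lK e0.
pose Q u := B u u / 2 - l u.
have QE u s v : Q (u + s *: v) = Q u + s * (B u v - l v) + s ^+ 2 * (B v v / 2).
  by rewrite /Q Blin (Bsym u (_ + _)) (Bsym v (_ + _)) !Blin llin (Bsym v u); field.
have Qge u : - (K / 2) <= Q u.
  rewrite leNgt; apply/negP; rewrite /Q => Qu.
  (* A value below [- (K / 2)] would give [4 * l u ^+ 2 > (B u u + K) ^+ 2 >= 4 * K * B u u]. *)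
  have : 0 < (2 * l u - (B u u + K)) * (2 * l u + (B u u + K)).
    by apply: mulr_gt0; have := Bge0 u; lra.
  by have := sqr_ge0 (B u u - K); have := lK u; lra.
have Qinf : has_inf (range Q).
  by split; [exists (Q 0), 0 | exists (- (K / 2)) => _ [u _ <-]].
have infQ u : inf (range Q) <= Q u by apply: ge_inf; [exact: Qinf.2 | exists u].
have /choice[u uP] n : exists u, Q u < inf (range Q) + e n.
  by have [_ [u _ <-] ?] := inf_adherent (e0 n) Qinf; exists u.
exists u; split=> [n m|n v].
  (* The steps [-1] and [- 2^-1] lead to [u m] and to the midpoint; eliminating the linear term
     gives the parallelogram law. *)
  have := QE (u n) (-1) (u n - u m); have := QE (u n) (- 2^-1) (u n - u m).
  rewrite scaleN1r subKr.
  have := infQ (u n + - 2^-1 *: (u n - u m)); have := uP n; have := uP m.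
  by lra.
rewrite (_ : 2 * e n * B v v = 4 * e n * (B v v / 2)); last by field.
apply: discriminant_le => [|s]; first by rewrite divr_ge0.
by have := infQ (u n + s *: v); rewrite QE; have := uP n; lra.
Qed.

Section Range.
Context (R : realType) (X Y : completeNormedModType R).
Context (A : {linear X -> Y}) (cA : continuous A).
Context (T : {linear dual X -> dual (dual X)}) (cT : continuous T).
Hypothesis Tsym : forall h k, T h k = T k h.
Hypothesis Tge0 : forall h, 0 <= T h h.
Hypothesis Trepr : forall h, exists x, forall k, T h k = k x.

Lemma adjointD (w v : dual Y) (s : R) :
  adjoint cA (w + s *: v) = adjoint cA w + s *: adjoint cA v.
Proof. exact: dual_ext. Qed.

Let TDZ (h k l : dual X) (s : R) : T (h + s *: k) l = T h l + s * T k l.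
Proof.
have -> : T (h + s *: k) = T h + s *: T k by rewrite linearD linearZ_LR.
by [].
Qed.

Lemma psd_cauchy_schwarz h k : T h k ^+ 2 <= T h h * T k k.
Proof.
suff : (2 * T h k) ^+ 2 <= 4 * T h h * T k k by rewrite exprMn; lra.
apply: discriminant_le => // s; have := Tge0 (h + s *: k).
by rewrite TDZ (Tsym h (_ + _)) (Tsym k (_ + _)) !TDZ (Tsym k h); lra.
Qed.

(** Cauchy-Schwarz and boundedness of [T] control the norm of [T h] by the seminorm of [h], so
    Cauchy in the seminorm becomes Cauchy in norm after applying [T]. *)
Lemma psd_bounded : exists2 S : R, 0 < S & forall h k : dual X,
  T h k ^+ 2 <= T h h * (S * `|k|) ^+ 2.
Proof.
have /linear_boundedP/pinfty_ex_gt0[M M0 TM] : bounded_near T (nbhs 0).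
  exact/linear_bounded_continuous.
exists (1 + M) => [|h k]; first by rewrite addr_gt0.
apply: le_trans (psd_cauchy_schwarz h k) _; rewrite ler_wpM2l//.
apply: le_trans (ler_norm _) _; apply: le_trans (le_opnorm (T k) k) _.
apply: (@le_trans _ _ (M * `|k| * `|k|)); first by rewrite ler_wpM2r//; exact: TM.
rewrite exprMn expr2 mulrA -[leRHS]mulrA -[leLHS]mulrA ler_wpM2r ?mulr_ge0//.
by nra.
Qed.

Lemma range_of_quadratic_bound (J : Y) (K : R) : 0 <= K ->
  (forall w : dual Y, w J ^+ 2 <= K * T (adjoint cA w) (adjoint cA w)) ->
  range A J.
Proof.
move=> K0 JK.
pose B (w v : dual Y) : R := T (adjoint cA w) (adjoint cA v).
pose e n : R := n.+1%:R^-1.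
have e0 n : 0 < e n by rewrite invr_gt0 ltr0n.
have ecvg : e @ \oo --> 0 by exact: cvg_harmonic.
(* With tolerances [e n ^+ 2], the bounds become linear in [e n] after taking square roots. *)
have [||||n|u [uC uJ]] :=
  @quadratic_minimising_sequence R (dual Y) B (fun w => w J) K (fun n => e n ^+ 2) _ _ _ _ K0 JK.
- by move=> w v; exact: Tsym.
- by move=> w s v z; rewrite /B adjointD TDZ.
- by move=> w; exact: Tge0.
- by [].
- exact: exprn_gt0.
have [S S0 TS] := psd_bounded.
have /choice[x xP] n : exists x, forall k, T (adjoint cA (u n)) k = k x by exact: Trepr.
have xC n m : `|x n - x m| <= 2 * S * e n + 2 * S * e m.
  rewrite -mulrDr; apply: norm_le_dual => [|k].
    by rewrite !mulr_ge0 ?addr_ge0// ltW.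
  have -> : k (x n - x m) = T (adjoint cA (u n - u m)) k.
    by rewrite linearB/= -!xP -scaleN1r adjointD TDZ mulN1r.
  have r0 : 0 <= 2 * S * (e n + e m) * `|k|.
    by rewrite !mulr_ge0 ?addr_ge0// ltW.
  rewrite -[leRHS]ger0_norm// -ler_sqr ?nnegrE// !real_normK ?num_real//.
  apply: le_trans (TS _ _) _.
  apply: le_trans (ler_wpM2r (sqr_ge0 _) (uC n m)) _.
  rewrite !exprMn; have := sqr_ge0 (S * `|k|); have := e0 n; have := e0 m.
  rewrite exprMn => a0 b0 c0.
  rewrite (_ : 2 ^+ 2 * S ^+ 2 * (e n + e m) ^+ 2 * `|k| ^+ 2 =
      4 * (e n + e m) ^+ 2 * (S ^+ 2 * `|k| ^+ 2)); last by ring.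
  by rewrite ler_wpM2r// ler_wpM2l//; nra.
have /cvg_ex[y xy] : cvg (x @ \oo).
  apply: (@cvg_of_dist_le _ _ _ (fun n => 2 * S * e n)) => //.
  by rewrite -[X in _ --> X](mulr0 (2 * S)); apply: cvgMr.
exists y => //; apply: dual_separates => w.
have h1 : w (A (x n)) @[n --> \oo] --> w (A y).
  apply: continuous_cvg; first exact: dual_continuous.
  by apply: continuous_cvg xy; exact: cA.
have h2 : w (A (x n)) @[n --> \oo] --> w J.
  apply/subr_cvg0; apply: norm_cvg0.
  (* The factor [2 * (1 + B w w)] dominates the square root of [2 * B w w]. *)
  apply: (@squeeze_cvgr _ _ _ _ (fun=> 0) (fun n => 2 * (1 + B w w) * e n)); last 2 first.
  - exact: cvg_cst.
  - by rewrite -[X in _ --> X](mulr0 (2 * (1 + B w w))); apply: cvgMr.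
  near=> n; rewrite normr_ge0/=.
  have Bw : 0 <= B w w by exact: Tge0.
  have -> : w (A (x n)) = B (u n) w by rewrite /B xP.
  have r0 : 0 <= 2 * (1 + B w w) * e n by rewrite !mulr_ge0 ?addr_ge0// ltW.
  rewrite -[leRHS]ger0_norm// -ler_sqr ?nnegrE// !real_normK ?num_real//.
  apply: le_trans (uJ n w) _; rewrite exprMn (mulrC _ (B w w)) mulrA ler_wpM2r ?sqr_ge0//.
  by nra.
by have := cvg_unique _ h1 h2; apply.
Unshelve. all: by end_near. Qed.

End Range.

(** * Consequences of the variational inequality *)

(** The source condition makes [x0] a maximiser in the supremum defining the conjugate at [xi0]; the
    same [x0] is a competitor at [v]. *)
Lemma subdifferential_conjugate (R : realType) (X : normedModType R)
    (Rf : X -> \bar R) (x0 : X) (xi0 : dual X) :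
  subdifferential Rf x0 xi0 -> forall v : dual X,
  (conjugate Rf xi0 + ((v - xi0) x0)%:E <= conjugate Rf v)%E.
Proof.
move=> [Rfx sub] v; apply: (@le_trans _ _ ((v x0)%:E - Rf x0)%E); last first.
  by apply: ereal_sup_ubound; exists x0.
rewrite -leeBrDr//; apply: ge_ereal_sup => _ [z _ <-].
have -> : (v - xi0) x0 = v x0 - xi0 x0 by [].
have := sub z; rewrite linearB/= -(fineK Rfx).
case: (Rf z) => [r||]//=.
- by rewrite -!EFinD !lee_fin; lra.
- by move=> _; rewrite leNye.
Qed.

Section VariationalInequality.
Context (R : realType) (X Y : completeNormedModType R).
Context (A : {linear X -> Y}) (cA : continuous A).
Context (Rf : X -> \bar R) (x0 : X) (w0 : dual Y) (J : Y) (Phi : R -> R).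
Context (T : {linear dual X -> dual (dual X)}).
Local Notation xi0 := (adjoint cA w0).
Hypothesis Fxi0 : conjugate Rf xi0 \is a fin_num.
Hypothesis bounds : forall (h : dual X) (e : R), 0 < e -> \forall t \near 0^'+,
  [/\ conjugate Rf (t *: h + xi0) \is a fin_num,
      0 <= taylor1 (conjugate Rf) xi0 x0 h t
    & taylor1 (conjugate Rf) xi0 x0 h t <= t ^+ 2 * (T h h / 2 + e)].
Hypothesis Tge0 : forall h : dual X, 0 <= T h h.
Hypothesis Phi_index : index_function Phi.
Hypothesis Phi_var : dual_variational_inequality cA Rf x0 w0 J Phi.

(** At [w0 + t *: w] the Bregman distance is at most [t ^+ 2 * q]; the square root of this is linear
    in [t], and [t] cancels. The term [e] keeps [q] positive, as the bound on [Phi] is given at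
    positive arguments. *)
Lemma pairing_le_of_sqrt_bound (c e : R) (w : dual Y) : 0 < e ->
  (\forall t \near 0^'+, Phi t <= c * Num.sqrt t) ->
  w J <= c * Num.sqrt (T (adjoint cA w) (adjoint cA w) / 2 + e).
Proof.
move=> e0 Phic; set h := adjoint cA w; set q := _ + e.
have q0 : 0 < q by rewrite ltr_wpDl// divr_ge0.
have [r /= r0 rP] := Phic.
have Phimono a b : 0 <= a -> a <= b -> Phi a <= Phi b.
  move=> a0; rewrite le_eqVlt => /predU1P[->//|ab].
  have [incr _ _ _ _] := Phi_index; apply/ltW/incr => //.
    by rewrite in_itv/= a0.
  by rewrite in_itv/= andbT (le_trans a0)// ltW.
near (0 : R)^'+ => t; have t0 : 0 < t by [].
have t1 : t <= 1 by near: t; exact: nbhs_right_le.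
have tr : t < r / q by near: t; apply: nbhs_right_lt; rewrite divr_gt0.
have [Ft E0 Et] : [/\ conjugate Rf (t *: h + xi0) \is a fin_num,
      0 <= taylor1 (conjugate Rf) xi0 x0 h t
    & taylor1 (conjugate Rf) xi0 x0 h t <= t ^+ 2 * q].
  by near: t; exact: bounds.
have := @Phi_var (w0 + t *: w).
have -> : adjoint cA (w0 + t *: w) = t *: h + xi0 by rewrite adjointD addrC.
have -> : dual_bregman Rf x0 (t *: h + xi0) xi0 =
    (taylor1 (conjugate Rf) xi0 x0 h t)%:E.
  rewrite /dual_bregman /taylor1 addrK -(fineK Ft) -(fineK Fxi0).
  by rewrite -!EFinN -!EFinD.
have -> : (w0 + t *: w - w0) J = t * w J by rewrite addrAC subrr add0r.
cbv zeta; rewrite ltry => /(_ isT) /= tw.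
have t2q : 0 < t ^+ 2 * q by rewrite mulr_gt0 ?exprn_gt0.
have : t * w J <= c * (t * Num.sqrt q).
  rewrite -[t in c * (t * _)]gtr0_norm// -sqrtr_sqr -sqrtrM ?sqr_ge0//.
  apply: (le_trans tw); apply: (le_trans (Phimono _ _ E0 Et)).
  apply: rP => //=; rewrite sub0r normrN gtr0_norm//.
  rewrite expr2 -mulrA (le_lt_trans (ler_piMl _ t1)) ?mulr_ge0 ?ltW//.
  by rewrite -ltr_pdivlMr.
by rewrite mulrCA ler_pM2l.
Unshelve. all: by end_near. Qed.

Lemma littleo_sqrt_pairing_le0 (w : dual Y) :
  Phi =o_ (0^'+) (@Num.sqrt R) -> w J <= 0.
Proof.
move=> /eqoP Phio; apply/ler_addgt0Pr => d d0; rewrite add0r.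
set s := Num.sqrt (T (adjoint cA w) (adjoint cA w) / 2 + 1).
have s0 : 0 <= s by exact: sqrtr_ge0.
have s10 : 0 < 1 + s by rewrite ltr_pwDl.
(* The little-o condition supplies every positive constant; this one keeps the bound below [d]. *)
apply: (@le_trans _ _ (d / (1 + s) * s)).
  apply: pairing_le_of_sqrt_bound => //.
  have := Phio (d / (1 + s)) (divr_gt0 d0 s10); apply: filterS => t.
  by rewrite /= (ger0_norm (sqrtr_ge0 _)); apply: le_trans; exact: ler_norm.
by rewrite mulrAC ler_pdivrMr// ler_pM2l// lerDr.
Qed.

(** The pairing bound for both [w] and [- w] controls the absolute value; one squares it and lets
    [e] tend to 0. *)
Lemma sqrt_pairing_sqr_le (c : R) (w : dual Y) : 0 <= c ->
  (\forall t \near 0^'+, Phi t <= c * Num.sqrt t) ->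
  w J ^+ 2 <= c ^+ 2 / 2 * T (adjoint cA w) (adjoint cA w).
Proof.
move=> c0 Phic; have pair (v : dual Y) (e : R) (e0 : 0 < e) := pairing_le_of_sqrt_bound v e0 Phic.
set q := T _ _; have q0 : 0 <= q by exact: Tge0.
have wJ e : 0 < e -> w J ^+ 2 <= c ^+ 2 * (q / 2 + e).
  move=> e0; have qe0 : 0 <= q / 2 + e by rewrite addr_ge0 ?divr_ge0// ltW.
  have wle : `|w J| <= c * Num.sqrt (q / 2 + e).
    rewrite ler_norml pair// andbT lerNl.
    have := pair (- w) e e0.
    have -> : adjoint cA (- w) = - adjoint cA w by exact: dual_ext.
    have -> : T (- adjoint cA w) (- adjoint cA w) = q.
      have -> (h : dual X) : T (- h) (- h) = - T (- h) h by exact: linearN.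
      have -> : T (- adjoint cA w) = - T (adjoint cA w) by rewrite linearN.
      by rewrite dualNE opprK.
    by [].
  rewrite -(sqr_sqrtr qe0) -exprMn -(real_normK (num_real (w J))).
  by rewrite ler_sqr ?nnegrE ?mulr_ge0 ?sqrtr_ge0.
apply/ler_addgt0Pr => d d0.
have c20 : 0 < 1 + c ^+ 2 by rewrite ltr_pwDl// sqr_ge0.
apply: le_trans (wJ (d / (1 + c ^+ 2)) (divr_gt0 d0 c20)) _.
have -> : c ^+ 2 * (q / 2 + d / (1 + c ^+ 2)) =
    c ^+ 2 / 2 * q + d * (c ^+ 2 / (1 + c ^+ 2)) by field; rewrite gt_eqF.
by rewrite lerD2l ler_piMr ?(ltW d0)// ler_pdivrMr// mul1r lerDr.
Qed.

End VariationalInequality.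

Theorem lemma5p1 (R : realType) (X Y : completeNormedModType R)
    (p pstar : R) (hp : 1 < p) (hpstar : p^-1 + pstar^-1 = 1)
    (A : {linear X -> Y}) (cA : continuous A)
    (Rf : X -> \bar R)
    (Rf_ge0 : forall x, (0 <= Rf x)%E)
    (Rf_convex : convex_ereal Rf)
    (Rf_lsc : lower_semicontinuous Rf)
    (Rf_coercive : coercive Rf)
    (ydag : Y) (xdag : X)
    (xdag_min : argmin Rf [set x | A x = ydag] xdag)
    (wdag : dual Y)
    (source : subdifferential Rf xdag (adjoint cA wdag))
    (J : Y) (HJ : is_duality_image pstar wdag J)
    (Rconj_diff2 : twice_frechet_differentiable (conjugate Rf) (adjoint cA wdag)) :
  ((exists Phi : R -> R,
      [/\ index_function Phi,
          dual_variational_inequality cA Rf xdag wdag J Phi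
        & Phi =o_ (0^'+) (@Num.sqrt R)]) ->
    argmin Rf [set: X] xdag)
  /\
  ((exists Phi : R -> R,
      [/\ index_function Phi,
          dual_variational_inequality cA Rf xdag wdag J Phi
        & comparable_at0 Phi (@Num.sqrt R)]) ->
    range A J).
Proof.
have [D [Ffin FD DD]] := Rconj_diff2.
have sub := subdifferential_conjugate source.
have FDrepr : \forall u \near adjoint cA wdag,
  exists x, (forall h : dual X, D u h = h x) /\
    (forall v : dual X, (conjugate Rf u + ((v - u) x)%:E <= conjugate Rf v)%E).
  (* The representation at [u] requires finiteness in a whole neighbourhood of [u]. *)
  have Ffin2 := near_join Ffin.
  move: Ffin2 FD; apply: filterS2 => u Fu FDu.
  exact: conjugate_diff_repr.
pose T : {linear dual X -> dual (dual X)} := 'd D (adjoint cA wdag).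
have DT : is_diff (adjoint cA wdag) D T by exact: differentiableP.
have cT : continuous T by exact: diff_continuous.
have Fxi := nbhs_singleton Ffin.
have Tsym h k : T h k = T k h.
  exact: (second_derivative_sym Ffin FD FDrepr DT sub).
have Tge0 h : 0 <= T h h.
  exact: (second_derivative_ge0 Ffin FD FDrepr DT sub).
have Trepr h : exists x, forall k, T h k = k x.
  exact: (second_derivative_repr Ffin FD FDrepr DT sub).
have bounds h e : 0 < e -> \forall t \near 0^'+,
    [/\ conjugate Rf (t *: h + adjoint cA wdag) \is a fin_num,
      0 <= taylor1 (conjugate Rf) (adjoint cA wdag) xdag h t
    & taylor1 (conjugate Rf) (adjoint cA wdag) xdag h t <= t ^+ 2 * (T h h / 2 + e)].
  exact: (taylor1_bounds Ffin FD FDrepr DT sub).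
split=> [[Phi [Phi_index Phi_var Phio]]|[Phi [Phi_index Phi_var]]].
  have wJ := littleo_sqrt_pairing_le0 Fxi bounds Tge0 Phi_index Phi_var wdag Phio.
  (* [wdag J] is the product of [|wdag|] and a power of [|wdag|], hence positive for nonzero
     [wdag]. *)
  have w0 : wdag = 0.
    apply/eqP; rewrite -normr_eq0; apply/negPn/negP => nw.
    have nw0 : 0 < `|wdag| by rewrite lt_neqAle eq_sym nw normr_ge0.
    have [wE JE] := HJ; move: wJ; rewrite leNgt => /negP; apply.
    by rewrite wE JE mulr_gt0// powR_gt0.
  have [_ sub0] := source; split=> // z _.
  have := sub0 z; rewrite w0.
  have -> : adjoint cA 0 (z - xdag) = 0 by [].
  by rewrite adde0.
move=> [c1 [c2 [c10 c12 cPhi]]].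
have c20 : 0 <= c2 by rewrite (le_trans (ltW c10)).
apply: (range_of_quadratic_bound cT Tsym Tge0 Trepr (K := c2 ^+ 2 / 2)).
  by rewrite divr_ge0 ?sqr_ge0.
move=> w; apply: (sqrt_pairing_sqr_le Fxi bounds Tge0 Phi_index Phi_var) => //.
by apply: filterS cPhi => t /andP[].
Qed.
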